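(* Let $d_1,\ldots,d_N$ be positive integers with $d_1+\cdots+d_N=d$. For each pair of admissible topologies $T\prec T'$ on $\{1,\ldots,N\}$ there exists a polynomial $p_{T,T'}$ with integer coefficients in $2N+1$ non-commuting variables such that $$\varphi_W^{-1}\circ\varphi_V(f)=p_{T,T'}(f,\pi_{V_1},\ldots,\pi_{V_N},\pi_{W_1},\ldots,\pi_{W_N})$$ for all $T'$-compatible splittings $V,W$ and all $f\in\mathrm{Nil}_{T,T'}(V)$.
   Context: For $I\subset\{1,\ldots,N\}$ put $d(I)=\sum_{i\in I}d_i$. For a topology $T$ on $\{1,\ldots,N\}$, $T(i)$ denotes the atom of $i$ (the smallest open set containing $i$). $T$ is admissible if $T(i)\subset\{i,\ldots,N\}$ for all $i$; $T\prec T'$ means $T(i)\subset T'(i)$ for all $i$. $\mathcal{X}_T$ is the space of sequences $(x_I)_{I\in T}$ with $x_I$ a $d(I)$-dimensional subspace of $\mathbb{R}^d$, $x_{I\cup J}=x_I+x_J$ and $x_{I\cap J}=x_I\cap x_J$ for all $I,J\in T$. $\pi_{T,T'}:\mathcal{X}_T\to\mathcal{X}_{T'}$ forgets the $x_I$ with $I\in T\setminus T'$, and $\mathcal{X}_{T,T'}^{x'}=\pi_{T,T'}^{-1}(x')$. A sequence of subspaces $V=(V_1,\ldots,V_N)$ is a splitting compatible with $x'\in\mathcal{X}_{T'}$ if $x'_I=\bigoplus_{i\in I}V_i$ for all $I\in T'$ (so $\dim V_i=d_i$ and $\mathbb{R}^d=\bigoplus_iV_i$). Two splittings $V,W$ are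 $T'$-compatible if there is $x'\in\mathcal{X}_{T'}$ such that both are compatible with $x'$. $\pi_{V_i}$ is the projection of $\mathbb{R}^d$ onto $V_i$ along $\bigoplus_{j\ne i}V_j$, and similarly $\pi_{W_i}$. $\mathrm{Nil}_{T,T'}(V)$ is the space of linear maps $f:\mathbb{R}^d\to\mathbb{R}^d$ with $f(V_i)\subset\bigoplus_{j\in T'(i)\setminus T(i)}V_j$ for all $i$. The map $\varphi_V:\mathrm{Nil}_{T,T'}(V)\to\mathcal{X}_{T,T'}^{x'}$ is $\varphi_V(f)_I=(\mathrm{Id}+f)\big(\bigoplus_{i\in I}V_i\big)$ for $I\in T$; it is a bijection. Products of maps are compositions. *)

(* Defs.v *)
From HB Require Import structures.
From mathcomp Require Import all_boot all_order all_algebra.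
From mathcomp Require Import finmap classical_sets functions reals.
From mathcomp.multinomials Require Import monalg.

Set Implicit Arguments.
Unset Strict Implicit.
Unset Printing Implicit Defensive.

Import GRing.Theory.
Local Open Scope ring_scope.

Section Topologies.
Variable N : nat.
Implicit Types (T : {set {set 'I_N}}) (i j : 'I_N).

(* Since 'I_N is finite, binary unions account for arbitrary ones. *)
Definition is_topology T : Prop :=
  [/\ finset.set0 \in T, [set: 'I_N] \in T,
      {in T &, forall I J, I :|: J \in T}
    & {in T &, forall I J, I :&: J \in T}].

Definition atom T i : {set 'I_N} := \bigcap_(I in T | i \in I) I.

Definition admissible T : Prop :=
  is_topology T /\ forall i j, j \in atom T i -> (i <= j)%N.

Definition prec T T' : Prop := forall i, atom T i \subset atom T' i.

End Topologies.

Notation opens T := {I | I \in T}.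

Section Splittings.
Variables (R : realType) (N d : nat) (d_ : 'I_N -> nat).
Local Notation E := 'cV[R]_d.
Implicit Types (T : {set {set 'I_N}}) (V W : 'I_N -> {vspace E}).

Definition dsum (I : {set 'I_N}) : nat := (\sum_(i in I) d_ i)%N.

(* The space X_T. *)
Definition is_config T (x : {ffun opens T -> {vspace E}}) : Prop :=
  [/\ forall I, \dim (x I) = dsum (val I),
      forall I J K, val K = val I :|: val J -> x K = (x I + x J)%VS
    & forall I J K, val K = val I :&: val J -> x K = (x I :&: x J)%VS].

Definition compatible T (x : {ffun opens T -> {vspace E}}) V : Prop :=
  forall I : opens T,
    directv (\sum_(i in val I) V i) /\ x I = (\sum_(i in val I) V i)%VS.

Definition compatible_splittings T V W : Prop :=
  exists x : {ffun opens T -> {vspace E}},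
    [/\ is_config x, compatible x V & compatible x W].

Definition proj V i : 'End(E) := daddv_pi (V i) (\sum_(j | j != i) V j).

Definition Nil_space T T' V : set 'End(E) :=
  [set f | forall i,
    (f @: V i <= \sum_(j in (atom T' i :\: atom T i)%SET) V j)%VS]%classic.

Definition phi T V (f : 'End(E)) : {ffun opens T -> {vspace E}} :=
  [ffun I : opens T => ((\1 + f) @: \sum_(i in val I) V i)%VS].

(* When x' in X_T' is compatible with V, phi T V is a bijection from
   Nil_space T T' V onto the fiber of X_T -> X_T' over x', and phi_inv is its
   inverse; the default value 0 is only taken outside that fiber. *)
Definition phi_inv T T' V : {ffun opens T -> {vspace E}} -> 'End(E) :=
  'pinv_(fun=> 0) (Nil_space T T' V) (phi T V).

End Splittings.
Arguments phi_inv {R N d} T T' V x.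

(* Integer polynomials in n non-commuting variables: the algebra over int of
   the free monoid of words in 'I_n. *)
Definition ncpoly (n : nat) := {malg int[{fmonom 'I_n}]}.

(* A word i1 i2 .. ik is evaluated to x_i1 \o x_i2 \o .. \o x_ik.  We do not
   use monalg.mmap because endomorphisms of a possibly zero-dimensional space
   do not form a nonzero ring. *)
Definition nceval (K : fieldType) (vT : vectType K) (n : nat)
    (p : ncpoly n) (x : n.-tuple 'End(vT)) : 'End(vT) :=
  \sum_(m <- msupp p)
    (\big[@comp_lfun _ vT vT vT / \1%VF]_(i <- (m : seq 'I_n)) tnth x i)
      *~ mcoeff m p.

(* Main.v *)
Require Import Defs.
From HB Require Import structures.
From mathcomp Require Import all_boot all_order all_algebra.
From mathcomp Require Import finmap classical_sets functions reals.
From mathcomp.multinomials Require Import monalg.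

Set Implicit Arguments.
Unset Strict Implicit.
Unset Printing Implicit Defensive.

(** The proof computes [g = phi_W^-1 (phi_V f)] by block elimination on the
    operator [1 + f], every step of which is a ring operation.

    Let [u = \sum_i pi_(V_i) pi_(W_i)].  It sends [W_i] into [V_i].  Both
    splittings are compatible with the same point of [X_T'], and [T'(i)] and
    [T'(i) \ i] are open, so [u - 1] sends [W_i] into the sum of the [W_j],
    [j] in [T'(i) \ i] ([transfer_punctured]).  By admissibility this makes [u]
    unipotent, hence an isomorphism carrying each [W_i] onto [V_i].  The same
    triangularity, relative to [W], holds for [m] defined by
    [1 + m = (1 + f) u].

    It remains to correct [m], which may have entries at all positions [(i, j)]
    with [j] in [T'(i) \ i], into an element of [Nil_(T,T') (W)].  If the
    entries of [e] sit at positions with [j] in [T(i) \ i], then [1 + e] is an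
    automorphism of every [W_I], [I] in [T], so multiplying [1 + m] by it on the
    right does not change the images of the [W_I]; and [(1 + m) (1 + e) - 1] has
    no entry with [j] in [T(i)] as soon as [e = - Q (m (1 + e))], where [Q]
    erases all other entries.  As [m] strictly increases the index, this
    equation in [e] is solved exactly by iterating it [N] times ([correction_fixed]).  Then
    [g = (1 + m) (1 + e) - 1] lies in [Nil_(T,T') (W)] and has the same image
    under [phi] as [f] ([phi_transported]).  The same strict triangularity
    makes [phi_W] injective ([phi_inj]), which identifies [g] with the value of
    the inverse.

    Since [Q] only multiplies by projections of [W], [g] is obtained from [f]
    and the projections by sums and products performed uniformly in
    [(V, W, f)], that is, by evaluating one integer polynomial. *)

Import GRing.Theory.
Local Open Scope ring_scope.

(** * Evaluation of non-commutative polynomials *)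

(** Endomorphisms of a possibly zero space form a ring in which 0 and 1 may
    coincide; the product is chosen to be composition in the usual order, so
    that words evaluate to products. *)
HB.instance Definition _ (K : fieldType) (vT : vectType K) :=
  GRing.Zmodule_isPzRing.Build 'End(vT)
    (@comp_lfunA _ _ _ _ _) (@comp_lfun1l _ _ _) (@comp_lfun1r _ _ _)
    (@comp_lfunDl _ _ _ _) (@comp_lfunDr _ _ _ _).

Lemma mul_endE (K : fieldType) (vT : vectType K) (f g : 'End(vT)) v :
  (f * g) v = f (g v).
Proof. exact: comp_lfunE. Qed.

Lemma one_endE (K : fieldType) (vT : vectType K) (v : vT) :
  (1 : 'End(vT)) v = v.
Proof. exact: id_lfunE. Qed.

Section Evaluation.
Variables (K : fieldType) (vT : vectType K) (n : nat).
Implicit Types (p q : ncpoly n) (x : n.-tuple 'End(vT)).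

Local Notation word x m := (\prod_(i <- (m : seq 'I_n)) tnth x i).

(** Summing over any finite set of words containing the support allows two
    polynomials to be compared term by term. *)
Lemma ncevalEw x p (D : {fset {fmonom 'I_n}}) : (msupp p `<=` D)%fset ->
  nceval p x = \sum_(m <- D) word x m *~ mcoeff m p.
Proof.
move=> sub; rewrite /nceval (big_fset_incl _ sub) // => m _ /mcoeff_outdom ->.
by rewrite mulr0z.
Qed.

Lemma ncevalD x : {morph (fun p => nceval p x) : p q / p + q}.
Proof.
move=> p q /=.
rewrite (ncevalEw x (msuppD_le p q)).
rewrite (ncevalEw x (fsubsetUl (msupp p) (msupp q))).
rewrite (ncevalEw x (fsubsetUr (msupp p) (msupp q))) -big_split /=.
by apply: eq_bigr => m _; rewrite mcoeffD mulrzDr.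
Qed.

Lemma nceval0 x : nceval 0 x = 0.
Proof. by rewrite /nceval msupp0 big_seq_fset0. Qed.

Lemma ncevalN x : {morph (fun p => nceval p x) : p / - p}.
Proof.
by move=> p /=; apply: (addrI (nceval p x)); rewrite -ncevalD !subrr nceval0.
Qed.

Lemma nceval_sum x (I : Type) (r : seq I) (F : I -> ncpoly n) :
  nceval (\sum_(i <- r) F i) x = \sum_(i <- r) nceval (F i) x.
Proof. exact: (big_morph (fun p => nceval p x) (ncevalD x) (nceval0 x)). Qed.

Lemma ncevalU x (c : int) (m : {fmonom 'I_n}) :
  nceval << c *g m >> x = word x m *~ c.
Proof.
by rewrite (ncevalEw x msuppU_le) big_seq_fset1 mcoeffUU.
Qed.

Lemma ncevalM x p q : nceval (p * q) x = nceval p x * nceval q x.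
Proof.
rewrite malgME nceval_sum [nceval p x]/nceval mulr_suml.
apply: eq_bigr => m _; rewrite nceval_sum mulr_sumr.
apply: eq_bigr => m' _; rewrite ncevalU fmM big_cat /=.
by rewrite mulrzA mulrzAr mulrzAl.
Qed.

Section PolynomialFamilies.
Variables (Z : Type) (x : Z -> n.-tuple 'End(vT)).

(** The quantifier over [p] comes first: this is what expresses that a
    construction performed on the data [x z] is given by a single polynomial. *)
Definition polynomial_in (F : Z -> 'End(vT)) :=
  exists p : ncpoly n, forall z, F z = nceval p (x z).

Lemma polynomial_in_var i : polynomial_in (fun z => tnth (x z) i).
Proof. by exists << fmu i >> => z; rewrite ncevalU fmU big_seq1. Qed.

Lemma polynomial_in0 : polynomial_in (fun=> 0).
Proof. by exists 0 => z; rewrite nceval0. Qed.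

Lemma polynomial_in1 : polynomial_in (fun=> 1).
Proof. by exists << fmone _ >> => z; rewrite ncevalU fm1 big_nil. Qed.

Lemma polynomial_inD F G : polynomial_in F -> polynomial_in G ->
  polynomial_in (fun z => F z + G z).
Proof. by move=> [p Fp] [q Gq]; exists (p + q) => z; rewrite ncevalD -Fp -Gq. Qed.

Lemma polynomial_inN F : polynomial_in F -> polynomial_in (fun z => - F z).
Proof. by move=> [p Fp]; exists (- p) => z; rewrite ncevalN -Fp. Qed.

Lemma polynomial_inM F G : polynomial_in F -> polynomial_in G ->
  polynomial_in (fun z => F z * G z).
Proof. by move=> [p Fp] [q Gq]; exists (p * q) => z; rewrite ncevalM -Fp -Gq. Qed.

Lemma polynomial_in_sum (I : finType) (P : pred I) (F : I -> Z -> 'End(vT)) :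
  (forall i, polynomial_in (F i)) ->
  polynomial_in (fun z => \sum_(i | P i) F i z).
Proof.
move=> polF; rewrite unlock; elim: (index_enum I) => [|i r IHr] /=.
  exact: polynomial_in0.
by case: (P i) => //; apply: polynomial_inD.
Qed.

End PolynomialFamilies.
End Evaluation.

(** * Block triangular elements relative to orthogonal idempotents *)

Section Blocks.
Variables (A : pzRingType) (N : nat) (p : 'I_N -> A).
Implicit Types (S : rel 'I_N) (X Y m e : A).

Definition orthogonal_idempotents :=
  (forall i j, p i * p j = if i == j then p i else 0) /\ \sum_i p i = 1.

(** [p j * X * p i] is the block of [X] from the [i]-th summand to the [j]-th:
    [S i j] reads source first. *)
Definition supported S X := forall i j, ~~ S i j -> p j * X * p i = 0.

Definition truncate S X := \sum_i \sum_(j | S i j) p j * X * p i.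

(** These supports filter the ring multiplicatively and [shift N] is empty,
    which is where nilpotence comes from. *)
Definition shift k : rel 'I_N := fun i j => (i + k <= j)%N.

Hypothesis p_idem : orthogonal_idempotents.

Let ppE i j : p i * p j = if i == j then p i else 0.
Proof. exact: p_idem.1. Qed.

Lemma eq_blocks X Y : (forall i j, p j * X * p i = p j * Y * p i) -> X = Y.
Proof.
move=> XY; rewrite -[X]mul1r -[Y]mul1r -[1 * X]mulr1 -[1 * Y]mulr1 -p_idem.2.
rewrite !mulr_suml; apply: eq_bigr => j _.
by rewrite !mulr_sumr; apply: eq_bigr => i _.
Qed.

Lemma block_truncate S X i j :
  p j * truncate S X * p i = if S i j then p j * X * p i else 0.
Proof.
rewrite /truncate mulr_sumr mulr_suml (bigD1 i) //= [X in _ + X]big1 => [|i' ni].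
  rewrite addr0 mulr_sumr mulr_suml big_mkcond (bigD1 j) //= big1 => [|j' nj].
    by rewrite !mulrA ppE eqxx -!mulrA ppE eqxx addr0.
  by rewrite !mulrA ppE eq_sym (negPf nj) !mul0r if_same.
rewrite mulr_sumr mulr_suml big1 // => j' _.
by rewrite -!mulrA ppE (negPf ni) !mulr0.
Qed.

Lemma truncate_supported S X : supported S (truncate S X).
Proof. by move=> i j /negPf nS; rewrite block_truncate nS. Qed.

Lemma truncate_sub S S' X : supported S' X -> supported S' (truncate S X).
Proof. by move=> sX i j nS; rewrite block_truncate sX ?if_same. Qed.

Lemma truncate_id S X : supported S X -> truncate S X = X.
Proof.
move=> sX; apply: eq_blocks => i j; rewrite block_truncate.
by case: ifPn => // /sX.
Qed.

Lemma truncateD S X Y : truncate S (X + Y) = truncate S X + truncate S Y.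
Proof.
apply: eq_blocks => i j; rewrite mulrDr mulrDl !block_truncate.
by case: ifP; rewrite ?addr0 // mulrDr mulrDl.
Qed.

Lemma truncateN S X : truncate S (- X) = - truncate S X.
Proof.
apply: eq_blocks => i j; rewrite mulrN mulNr !block_truncate.
by case: ifP; rewrite ?oppr0 // mulrN mulNr.
Qed.

Lemma supported_sub S S' X :
  subrel S S' -> supported S X -> supported S' X.
Proof. by move=> sS sX i j nS; apply: sX; apply: contra nS => /sS. Qed.

Lemma supported0 S : supported S 0.
Proof. by move=> i j _; rewrite mulr0 mul0r. Qed.

Lemma supported1 S : reflexive S -> supported S 1.
Proof.
by move=> rS i j nS; rewrite mulr1 ppE; case: eqP nS => // ->; rewrite rS.
Qed.

Lemma supportedD S X Y : supported S X -> supported S Y -> supported S (X + Y).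
Proof. by move=> sX sY i j nS; rewrite mulrDr mulrDl sX ?sY ?addr0. Qed.

Lemma supportedN S X : supported S X -> supported S (- X).
Proof. by move=> sX i j nS; rewrite mulrN mulNr sX ?oppr0. Qed.

(** Only the paths [i -> k -> j] contribute to the block [(i, j)] of a
    product. *)
Lemma supportedM S1 S2 S X Y :
    (forall i k j, S2 i k -> S1 k j -> S i j) ->
  supported S1 X -> supported S2 Y -> supported S (X * Y).
Proof.
move=> S12 sX sY i j nS.
rewrite -[X]mulr1 -p_idem.2 mulr_sumr mulr_suml mulr_sumr mulr_suml.
apply: big1 => k _.
have -> : p j * (X * p k * Y) * p i = (p j * X * p k) * (p k * Y * p i).
  by rewrite -!mulrA [p k * (p k * _)]mulrA ppE eqxx.
have [S2ik|/sY->] := boolP (S2 i k); last by rewrite mulr0.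
have [S1kj|/sX->] := boolP (S1 k j); last by rewrite mul0r.
by rewrite (S12 _ _ _ S2ik S1kj) in nS.
Qed.

Lemma shiftM k l X Y :
  supported (shift k) X -> supported (shift l) Y ->
  supported (shift (k + l)) (X * Y).
Proof.
apply: supportedM => i j h; rewrite /shift => ij jh.
by apply: leq_trans jh; rewrite [(k + l)%N]addnC addnA leq_add2r.
Qed.

Lemma shift_vanish X : supported (shift N) X -> X = 0.
Proof.
move=> sX; apply: eq_blocks => i j; rewrite sX ?mulr0 ?mul0r //.
by rewrite /shift -ltnNge ltn_addl.
Qed.

(** The inverse is the geometric sum, which is finite because [X ^+ N] raises
    the index by [N]. *)
Lemma unipotent_inv X :
  supported (shift 1) X -> exists2 Y, Y * (1 + X) = 1 & (1 + X) * Y = 1.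
Proof.
move=> sX; have sXn k : supported (shift k) ((- X) ^+ k).
  elim: k => [|k IHk].
    by rewrite expr0; apply: supported1 => i; rewrite /shift addn0.
  by rewrite exprS -add1n; apply: shiftM IHk; apply: supportedN.
have geom : (1 + X) * (\sum_(i < N) (- X) ^+ i) = 1.
  rewrite -[1 + X]opprK opprD addrC mulNr -subrX1.
  by rewrite (shift_vanish (sXn N)) sub0r opprK.
exists (\sum_(i < N) (- X) ^+ i) => //.
rewrite -[RHS]geom; apply/commr_sym/commr_sum => i _; apply: commrX.
apply/commr_sym/commrD; first exact: commr1.
by apply/commr_sym/commrN.
Qed.

Lemma supported_truncate0 S S' X : supported S' X -> truncate S X = 0 ->
  supported (fun i j => S' i j && ~~ S i j) X.
Proof.
move=> sX tX i j; rewrite negb_and negbK => /orP[/sX //|Sij].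
by have := block_truncate S X i j; rewrite Sij tX mulr0 mul0r.
Qed.

Lemma truncate_eq0 S X : supported (fun i j => ~~ S i j) X -> truncate S X = 0.
Proof.
move=> sX; apply: eq_blocks => i j; rewrite block_truncate mulr0 mul0r.
by case: ifP => // Sij; apply: sX; rewrite Sij.
Qed.

Section Factorization.
Variable S : rel 'I_N.
Hypothesis S_shift : subrel S (shift 0).

(** Blocks in [S] of the equation [h = h' + e + h' * e] give
    [e = - truncate S (h' * e)].  Each use of this equation raises the index
    further, so that [e = 0]. *)
Lemma factor_unique h h' e :
  supported (shift 1) h' -> supported S e ->
  truncate S h = 0 -> truncate S h' = 0 ->
  1 + h = (1 + h') * (1 + e) -> h = h'.
Proof.
move=> h'_shift e_supp th th' hE.
have {}hE : h = h' + (e + h' * e).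
  apply: (addrI 1); rewrite hE mulrDl mulrDr mulr1 mul1r.
  by rewrite mulrDr mulr1 -!addrA; congr (1 + _); rewrite addrCA.
suff e0 : e = 0 by rewrite hE e0 mulr0 !addr0.
have eE : e = - truncate S (h' * e).
  have := congr1 (truncate S) hE.
  rewrite !truncateD th th' add0r (truncate_id e_supp).
  by move/esym/eqP; rewrite addr_eq0 => /eqP.
apply: shift_vanish; elim: {1}N => [|k IHk].
  exact: supported_sub S_shift e_supp.
by rewrite eE -add1n; apply/supportedN/truncate_sub/shiftM.
Qed.

Variable m : A.
Hypothesis m_shift : supported (shift 1) m.

(** The iterates of [e |-> - truncate S (m * (1 + e))], whose fixed points are
    the [e] supported in [S] for which [(1 + m) * (1 + e) - 1] has no block
    in [S]. *)
Definition correction k := iter k (fun e => - truncate S (m * (1 + e))) 0.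

Definition reduction := (1 + m) * (1 + correction N) - 1.

Lemma correction_supported k : supported S (correction k).
Proof.
case: k => [|k]; first exact: supported0.
exact/supportedN/truncate_supported.
Qed.

(** The difference of two successive iterates raises the index by one more at
    each step, so that it vanishes after [N] of them. *)
Lemma correction_fixed : correction N = - truncate S (m * (1 + correction N)).
Proof.
suff dk k : supported (shift k) (correction k.+1 - correction k).
  by apply/esym/subr0_eq/shift_vanish; apply: dk.
elim: k => [|k IHk].
  rewrite subr0; apply/supportedN/truncate_sub; rewrite addr0 mulr1.
  by apply: supported_sub m_shift => i j; rewrite /shift addn0 addn1; apply: ltnW.
have -> : correction k.+2 - correction k.+1 =
          - truncate S (m * (correction k.+1 - correction k)).
  have -> : correction k.+1 - correction k =
            (1 + correction k.+1) - (1 + correction k).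
    by rewrite opprD addrACA subrr add0r.
  by rewrite mulrBr truncateD truncateN opprD.
by rewrite -add1n; apply/supportedN/truncate_sub/shiftM.
Qed.

Lemma correction_shift : supported (shift 1) (correction N).
Proof.
rewrite correction_fixed; apply/supportedN/truncate_sub.
apply: (shiftM (l := 0) m_shift); apply: supportedD.
  by apply: supported1 => i; rewrite /shift addn0.
exact: supported_sub S_shift (correction_supported _).
Qed.

Lemma reductionE : reduction = correction N + m * (1 + correction N).
Proof. by rewrite /reduction mulrDl mul1r addrAC [1 + _]addrC addrK. Qed.

Lemma truncate_reduction : truncate S reduction = 0.
Proof.
rewrite reductionE truncateD (truncate_id (correction_supported N)).
by rewrite {1}correction_fixed addNr.
Qed.

Lemma reduction_supported S' :
    reflexive S' -> (forall i j k, S' i j -> S' j k -> S' i k) ->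
    subrel S S' -> supported S' m ->
  supported S' reduction.
Proof.
move=> S'_refl S'_trans SS' m_supp; rewrite reductionE.
have e_supp := supported_sub SS' (correction_supported N).
apply: (supportedD e_supp); apply: (supportedM S'_trans m_supp).
exact/supportedD/e_supp/supported1.
Qed.

Lemma add1_reduction : 1 + reduction = (1 + m) * (1 + correction N).
Proof. by rewrite addrC subrK. Qed.

End Factorization.
End Blocks.

(** * Elimination is polynomial *)

Section Polynomiality.
Variables (K : fieldType) (vT : vectType K) (n N : nat).
Variables (Z : Type) (x : Z -> n.-tuple 'End(vT)).
Variables (p : Z -> 'I_N -> 'End(vT)) (S : rel 'I_N).
Hypothesis p_pol : forall i, polynomial_in x (fun z => p z i).

Lemma polynomial_in_truncate X : polynomial_in x X ->
  polynomial_in x (fun z => truncate (p z) S (X z)).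
Proof.
move=> polX; do 2!apply: polynomial_in_sum => ?.
by apply: polynomial_inM => //; apply: polynomial_inM.
Qed.

Lemma polynomial_in_correction m k : polynomial_in x m ->
  polynomial_in x (fun z => correction (p z) S (m z) k).
Proof.
move=> polm; elim: k => [|k IHk]; first exact: polynomial_in0.
apply/polynomial_inN/polynomial_in_truncate/polynomial_inM => //.
by apply: polynomial_inD IHk; apply: polynomial_in1.
Qed.

Lemma polynomial_in_reduction m : polynomial_in x m ->
  polynomial_in x (fun z => reduction (p z) S (m z)).
Proof.
move=> polm; have pol1 := polynomial_in1 x.
apply/polynomial_inD/polynomial_inN/pol1.
by apply: polynomial_inM; apply: polynomial_inD => //; apply: polynomial_in_correction.
Qed.

End Polynomiality.

(** * Atoms of an admissible topology *)

Section Atoms.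
Variables (N : nat) (T : {set {set 'I_N}}).
Hypothesis T_adm : admissible T.

Lemma mem_atom i : i \in atom T i.
Proof. by apply/finset.bigcapP => I /andP[]. Qed.

Lemma atom_subset i (I : {set 'I_N}) : I \in T -> i \in I -> atom T i \subset I.
Proof. by move=> TI iI; apply: finset.bigcap_inf; rewrite TI. Qed.

Lemma atom_open i : atom T i \in T.
Proof.
have [[_ TT _ TI] _] := T_adm; rewrite /atom.
by elim/big_ind: _ => // I /andP[].
Qed.

Lemma atom_trans i j : j \in atom T i -> atom T j \subset atom T i.
Proof. exact/atom_subset/atom_open. Qed.

(** If [j] is in [T(i)] and [i] is in [T(j)], admissibility forces [i = j];
    so [T(i) \ i] is the union of the atoms of its points. *)
Lemma punctured_atom_open i : atom T i :\ i \in T.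
Proof.
have [[T0 _ TU _] Tle] := T_adm.
suff -> : atom T i :\ i = \bigcup_(j in atom T i :\ i) atom T j.
  by elim/big_ind: _ => // j _; apply: atom_open.
apply/eqP; rewrite finset.eqEsubset; apply/andP; split.
  by apply/fintype.subsetP => j ij; apply/finset.bigcupP; exists j; rewrite ?mem_atom.
apply/finset.bigcupsP => j; rewrite !inE => /andP[nij ij].
rewrite subsetD1 atom_trans //=; apply: contra nij => ji.
by rewrite -val_eqE eqn_leq !Tle.
Qed.

End Atoms.

(** * Splittings and their projections *)

Section Decompositions.
Variables (R : realType) (N d : nat).
Local Notation E := 'cV[R]_d.
Implicit Types (V W : 'I_N -> {vspace E}) (I : {set 'I_N}) (X : 'End(E)).

Definition decomposition V :=
  directv (\sum_i V i) /\ (\sum_i V i = fullv)%VS.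

Lemma proj_mem V i v : proj V i v \in V i.
Proof. exact: memv_pi. Qed.

Section OneDecomposition.
Variable V : 'I_N -> {vspace E}.
Hypothesis V_dec : decomposition V.

Lemma decomposition_cap i : (V i :&: \sum_(j | j != i) V j = 0)%VS.
Proof. exact: (directv_sumP V_dec.1). Qed.

Lemma proj_id i v : v \in V i -> proj V i v = v.
Proof. exact/daddv_pi_id/decomposition_cap. Qed.

Lemma proj_out i j v : v \in V j -> j != i -> proj V i v = 0.
Proof.
move=> vVj ji; have vS : (v \in \sum_(k | k != i) V k)%VS.
  exact: (subvP (sumv_sup j ji (subvv _))).
have vVS : (v \in V i + \sum_(k | k != i) V k)%VS by exact: (subvP (addvSr _ _)).
have := daddv_pi_add (decomposition_cap i) vVS.
rewrite [X in _ + X]daddv_pi_id // 1?capvC ?decomposition_cap //.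
by move/(canRL (addrK _)); rewrite subrr.
Qed.

Lemma proj_idempotents : orthogonal_idempotents (proj V).
Proof.
split=> [i j|]; apply/lfunP => v.
  rewrite mul_endE; case: eqVneq => [<-|nij]; first exact/proj_id/proj_mem.
  by rewrite (proj_out (proj_mem V j v)) ?zero_lfunE // eq_sym.
rewrite sum_lfunE one_endE; have : v \in (\sum_i V i)%VS by rewrite V_dec.2 memvf.
case/memv_sumP => u uV ->; apply: eq_bigr => i _.
rewrite linear_sum (bigD1 i) //= proj_id ?uV // big1 ?addr0 // => j ji.
by rewrite (proj_out (uV j _)).
Qed.

Lemma sum_proj v : v = \sum_i proj V i v.
Proof. by rewrite -sum_lfunE proj_idempotents.2 one_endE. Qed.

Lemma span_blocksP I v :
  reflect (forall j, j \notin I -> proj V j v = 0) (v \in \sum_(i in I) V i)%VS.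
Proof.
apply: (iffP idP) => [/memv_sumP[u uV ->] j jI | vI].
  rewrite linear_sum big1 //= => i iI; rewrite (proj_out (uV i iI)) //.
  by apply: contraNneq jI => <-.
rewrite [v]sum_proj (bigID [in I]) /= [X in _ + X]big1 // addr0.
by apply: memv_sumr => i _; apply: proj_mem.
Qed.

(** This is the form in which [Nil_space] states triangularity. *)
Lemma supportedP (S : 'I_N -> {set 'I_N}) X :
  supported (proj V) (fun i j => j \in S i) X <->
  forall i v, v \in V i -> X v \in (\sum_(j in S i) V j)%VS.
Proof.
split=> [sX i v vVi | sX i j nS].
  apply/span_blocksP => j /sX/lfunP/(_ v).
  by rewrite !mul_endE (proj_id vVi) zero_lfunE; apply.
apply/lfunP => v; rewrite !mul_endE zero_lfunE.
by apply: (span_blocksP _ _ (sX i _ _)) => //; apply: proj_mem.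
Qed.

Lemma dim_blocks I :
  \dim (\sum_(i in I) V i) = (\sum_(i in I) \dim (V i))%N.
Proof.
suff /directvP : directv (\sum_(i in I) V i) by [].
apply/directv_sumP => i iI; apply/eqP; rewrite -subv0.
rewrite -[X in (_ <= X)%VS](decomposition_cap i) capvS //.
by apply/subv_sumP => j /andP[_ ji]; apply: (sumv_sup j).
Qed.

End OneDecomposition.

Lemma limg_blocks X V I (U : {vspace E}) :
  (forall i, i \in I -> forall v, v \in V i -> X v \in U) ->
  (X @: (\sum_(i in I) V i) <= U)%VS.
Proof.
move=> XV; rewrite limg_sum; apply/subv_sumP => i iI.
by apply/subvP => _ /memv_imgP[v vV ->]; apply: XV iI _ vV.
Qed.

(** For compatible splittings this is an isomorphism from each [W i] onto
    [V i], obtained from the projections without any choice. *)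
Definition transfer V W : 'End(E) := \sum_i proj V i * proj W i.

Lemma transfer_block V W i w :
  decomposition W -> w \in W i -> transfer V W w = proj V i w.
Proof.
move=> dW wW; rewrite sum_lfunE (bigD1 i) //= big1 ?addr0 => [|j ji].
  by rewrite mul_endE (proj_id dW wW).
have W0 : proj W j w = 0 by apply: (proj_out dW wW); rewrite eq_sym.
by rewrite mul_endE W0 raddf0.
Qed.

(** * Compatible splittings *)

Definition as_open (T : {set {set 'I_N}}) I (TI : I \in T) : opens T :=
  exist (fun J : {set 'I_N} => J \in T) I TI.

Section Compatible.
Variables (d_ : 'I_N -> nat) (T : {set {set 'I_N}}).
Hypotheses (sum_d : (\sum_(i < N) d_ i)%N = d) (T_adm : admissible T).

Lemma compatible_decomposition (x : {ffun opens T -> {vspace E}}) V :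
  is_config d_ x -> compatible x V -> decomposition V.
Proof.
have [[_ TT _ _] _] := T_adm.
move=> [xdim _ _] /(_ (as_open TT)) [/= dirV xV].
have setTE (P : pred 'I_N) : (fun j => (j \in [set: 'I_N]) && P j) =1 P.
  by move=> j; rewrite inE.
have sumVE : (\sum_(i in [set: 'I_N]) V i = \sum_i V i)%VS.
  by apply: eq_bigl => i; rewrite inE.
split.
  apply/directv_sumP => i _; have /directv_sumP/(_ i (finset.in_setT i)) := dirV.
  by rewrite (eq_bigl _ _ (setTE _)).
apply/eqP; rewrite eqEdim subvf /= -sumVE -xV xdim /= dimvf /dsum.
rewrite (eq_bigl xpredT) => [|i]; last by rewrite inE.
by rewrite sum_d /dim /= muln1.
Qed.

(** [x] gives the dimensions of the sums over the open sets [T(i)] and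
    [T(i) \ i], whose difference is the dimension of [V i]. *)
Lemma compatible_dim (x : {ffun opens T -> {vspace E}}) V i :
  is_config d_ x -> compatible x V -> \dim (V i) = d_ i.
Proof.
move=> cx xV; have dV := compatible_decomposition cx xV.
have dimV I : I \in T -> \dim (\sum_(j in I) V j) = dsum d_ I.
  by move=> TI; case: cx => xdim _ _; case: (xV (as_open TI)) => _ <-; rewrite xdim.
have := dimV _ (atom_open T_adm i).
rewrite /dsum (dim_blocks dV) !(big_setD1 i (mem_atom T i)) /=.
rewrite -(dim_blocks dV) dimV ?punctured_atom_open //; exact: addIn.
Qed.

Lemma compatible_span (x : {ffun opens T -> {vspace E}}) V W I :
  compatible x V -> compatible x W -> I \in T ->
  (\sum_(i in I) V i = \sum_(i in I) W i)%VS.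
Proof.
move=> xV xW TI; case: (xV (as_open TI)) => _ <-.
by case: (xW (as_open TI)).
Qed.

End Compatible.

(** * Changing the splitting *)

Section ChangeOfSplitting.
Variables (T T' : {set {set 'I_N}}).
Hypotheses (T_adm : admissible T) (T'_adm : admissible T') (TT' : prec T T').

Definition atom_rel (Q : {set {set 'I_N}}) : rel 'I_N := fun i j => j \in atom Q i.
Definition punctured (Q : {set {set 'I_N}}) : rel 'I_N :=
  fun i j => j \in atom Q i :\ i.

Lemma atom_rel_shift Q : admissible Q -> subrel (atom_rel Q) (shift 0).
Proof. by move=> [_ Qle] i j; rewrite /shift addn0; apply: Qle. Qed.

Lemma punctured_shift Q : admissible Q -> subrel (punctured Q) (shift 1).
Proof.
move=> [_ Qle] i j /finset.setD1P[ji /Qle]; rewrite /shift addn1.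
by rewrite leq_eqVlt val_eqE eq_sym (negPf ji).
Qed.

Lemma Nil_supported V f : decomposition V ->
  Nil_space T T' V f <->
  supported (proj V) (fun i j => j \in atom T' i :\: atom T i) f.
Proof.
move=> dV; split=> [nf | /(supportedP dV) sf i].
  by apply/(supportedP dV) => i v vV; apply: (subvP (nf i)); apply: memv_img.
by apply/subvP => _ /memv_imgP[v vV ->]; apply: sf.
Qed.

Lemma gap_punctured i : atom T' i :\: atom T i \subset atom T' i :\ i.
Proof. by apply: finset.setDS; rewrite finset.sub1set mem_atom. Qed.

Lemma Nil_punctured V f : decomposition V -> Nil_space T T' V f ->
  supported (proj V) (punctured T') f.
Proof.
move=> dV /(Nil_supported _ dV); apply: supported_sub => i j.
exact: (fintype.subsetP (gap_punctured i)).
Qed.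

Lemma Nil_truncate V f : decomposition V -> Nil_space T T' V f ->
  truncate (proj V) (atom_rel T) f = 0.
Proof.
move=> dV /(Nil_supported _ dV) sf; apply: (truncate_eq0 (proj_idempotents dV)).
by apply: supported_sub sf => i j /finset.setDP[].
Qed.

(** If [h] and [h'] have the same image then
    [1 + h = (1 + h') * (1 + e)], where [1 + e] maps each [W i] into the sum of
    the [W j] over the atom [T(i)], and [factor_unique] applies. *)
Lemma phi_inj W : decomposition W ->
  {in Nil_space T T' W &, injective (phi T W)}.
Proof.
move=> dW h h' /set_mem nh /set_mem nh' eq_phi.
have pW := proj_idempotents dW.
have h'_shift := supported_sub (punctured_shift T'_adm) (Nil_punctured dW nh').
have [L L1 L2] := unipotent_inv pW h'_shift.
apply: (factor_unique pW (atom_rel_shift T_adm) (e := L * (1 + h) - 1)) => //.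
- apply: supportedD; last first.
    by apply/supportedN/(supported1 pW) => i; apply: mem_atom.
  apply/(supportedP dW) => i w wW; rewrite mul_endE.
  have wS : w \in (\sum_(j in atom T i) W j)%VS.
    by apply: (subvP (sumv_sup i (mem_atom T i) (subvv _))).
  have := congr1 (fun x : {ffun opens T -> _} => x (as_open (atom_open T_adm i)))
            eq_phi.
  rewrite !ffunE /= => /vspaceP/(_ ((1 + h) w)).
  rewrite memv_img // => /esym/memv_imgP[w' w'S ->].
  by rewrite -mul_endE L1 one_endE.
- exact: Nil_truncate.
- exact: Nil_truncate.
by rewrite [1 + (_ - 1)]addrC subrK mulrA L2 mul1r.
Qed.

Section TwoSplittings.
Variables V W : 'I_N -> {vspace E}.
Hypotheses (V_dec : decomposition V) (W_dec : decomposition W).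
Hypothesis VW_span : forall I, I \in T' ->
  (\sum_(i in I) V i = \sum_(i in I) W i)%VS.
Hypothesis VW_dim : forall i, \dim (V i) = \dim (W i).

(** For [w] in [W i], the vector [proj V i w - w] belongs to the sum of the
    [V j] over [T'(i)], as [w] does, and has no component on [V i]. *)
Lemma transfer_punctured :
  supported (proj W) (punctured T') (transfer V W - 1).
Proof.
apply/(supportedP W_dec) => i w wW.
rewrite -VW_span ?punctured_atom_open // add_lfunE opp_lfunE one_endE.
rewrite (transfer_block V W_dec wW); apply/(span_blocksP V_dec) => j.
rewrite finset.in_setD1 negb_and negbK linearB /=.
case: (eqVneq j i) => [-> _|ji /= jT].
  by rewrite (proj_id V_dec (proj_mem V i w)) subrr.
rewrite (proj_out V_dec (proj_mem V i w)) 1?eq_sym // sub0r.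
apply/eqP; rewrite oppr_eq0; apply/eqP; apply: (span_blocksP V_dec _ _ _ _ jT).
rewrite VW_span ?atom_open //.
by apply: (subvP (sumv_sup i (mem_atom T' i) (subvv _))).
Qed.

(** For every [I], [1 + discrepancy f] maps the sum of the [W i] over
    [I] onto the image under [1 + f] of the sum of the [V i]; this form of
    [1 + f] has a source split by [W] and remains triangular for [W]. *)
Definition discrepancy f : 'End(E) := (1 + f) * transfer V W - 1.

Lemma discrepancy_punctured f : Nil_space T T' V f ->
  supported (proj W) (punctured T') (discrepancy f).
Proof.
move=> nf; rewrite /discrepancy mulrDl mul1r addrAC.
apply: supportedD; first exact: transfer_punctured.
apply/(supportedP W_dec) => i w wW.
rewrite mul_endE (transfer_block V W_dec wW) -VW_span ?punctured_atom_open //.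
move/(Nil_punctured V_dec)/(supportedP V_dec): nf; apply; exact: proj_mem.
Qed.

Definition transported f : 'End(E) :=
  reduction (proj W) (atom_rel T) (discrepancy f).

Variable f : 'End(E).
Hypothesis Nil_f : Nil_space T T' V f.

Let e := correction (proj W) (atom_rel T) (discrepancy f) N.
Let W_idem := proj_idempotents W_dec.

Let discrepancy_shift : supported (proj W) (shift 1) (discrepancy f).
Proof.
exact: supported_sub (punctured_shift T'_adm) (discrepancy_punctured Nil_f).
Qed.

Lemma transported_Nil : Nil_space T T' W (transported f).
Proof.
apply/(Nil_supported _ W_dec).
have trans0 := truncate_reduction W_idem (atom_rel T) discrepancy_shift.
have trans_T' : supported (proj W) (atom_rel T') (transported f).
  apply: (reduction_supported W_idem).
  - exact: mem_atom.
  - by move=> i j k ij; apply/(fintype.subsetP)/(atom_trans T'_adm).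
  - by move=> i j; apply: (fintype.subsetP (TT' i)).
  by apply: supported_sub (discrepancy_punctured Nil_f) => i j /finset.setD1P[].
apply: supported_sub (supported_truncate0 W_idem trans_T' trans0) => i j.
by rewrite finset.in_setD andbC.
Qed.

(** The correction stays inside the sum of the [W i] over [I] and the transfer
    takes it into the sum of the [V i]; both operators are unipotent, hence
    injective, so that equality follows by comparing dimensions. *)
Lemma transfer_correction_image I : I \in T ->
  ((transfer V W * (1 + e)) @: (\sum_(i in I) W i) = \sum_(i in I) V i)%VS.
Proof.
move=> TI; apply/eqP; rewrite eqEdim; apply/andP; split.
  apply: limg_blocks => i iI w wW; rewrite mul_endE.
  have : (1 + e) w \in (\sum_(j in I) W j)%VS.
    rewrite add_lfunE one_endE; apply: rpredD.
      exact: (subvP (sumv_sup i iI (subvv _))).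
    have sub : (\sum_(j in atom T i) W j <= \sum_(j in I) W j)%VS.
      apply/subv_sumP => j ij; apply: (sumv_sup j) => //.
      exact: (fintype.subsetP (atom_subset TI iI)).
    apply: (subvP sub); move: i w wW {iI sub}; apply/(supportedP W_dec).
    exact: correction_supported.
  move=> wS; apply: (subvP _ _ (memv_img (transfer V W) wS)).
  apply: limg_blocks => j jI u uW; rewrite (transfer_block V W_dec uW).
  apply: (subvP (sumv_sup j jI (subvv _))); exact: proj_mem.
have [L1 L1E _] := unipotent_inv W_idem
  (supported_sub (punctured_shift T'_adm) transfer_punctured).
have [L2 L2E _] := unipotent_inv W_idem
  (correction_shift W_idem (atom_rel_shift T_adm) discrepancy_shift).
rewrite limg_dim_eq; last first.
  apply/eqP; rewrite -subv0; apply/subvP => v; rewrite memv_cap memv_ker memv0.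
  case/andP=> _ /eqP X0; apply/eqP.
  rewrite addrC subrK in L1E.
  have -> : v = (L2 * (L1 * (transfer V W * (1 + e)))) v.
    by rewrite [L1 * _]mulrA L1E mul1r L2E one_endE.
  by rewrite mul_endE (mul_endE L1) X0 !raddf0.
rewrite (dim_blocks V_dec) (dim_blocks W_dec) leq_eqVlt.
by apply/orP; left; apply/eqP/eq_bigr.
Qed.

Lemma phi_transported : phi T W (transported f) = phi T V f.
Proof.
apply/ffunP => I; rewrite !ffunE /= -(transfer_correction_image (valP I)).
rewrite -limg_comp; congr (_ @: _)%VS.
rewrite -[(_ \o _)%VF]/((1 + f) * (transfer V W * (1 + e))) mulrA.
rewrite -[\1%VF]/(1 : 'End(E)) /transported add1_reduction.
by rewrite /discrepancy [1 + (_ - 1)]addrC subrK.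
Qed.

Lemma phi_inv_transported : phi_inv T T' W (phi T V f) = transported f.
Proof.
rewrite -phi_transported /phi_inv pinvKV //; first exact: phi_inj.
exact/mem_set/transported_Nil.
Qed.

End TwoSplittings.
End ChangeOfSplitting.
End Decompositions.

Theorem theorem5p1 (R : realType) (N d : nat) (d_ : 'I_N -> nat)
    (d_gt0 : forall i, (0 < d_ i)%N) (sum_d : (\sum_(i < N) d_ i)%N = d)
    (T T' : {set {set 'I_N}})
    (T_adm : admissible T) (T'_adm : admissible T') (TT' : prec T T') :
  exists p : ncpoly (N + N).+1,
    forall V W : 'I_N -> {vspace 'cV[R]_d},
      compatible_splittings d_ T' V W ->
      forall f : 'End('cV[R]_d), Nil_space T T' V f ->
        phi_inv T T' W (phi T V f) =
          nceval p [tuple of f :: [tuple proj V i | i < N]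
                                  ++ [tuple proj W i | i < N]].
Proof.
pose splitting := 'I_N -> {vspace 'cV[R]_d}.
pose x (z : splitting * splitting * 'End('cV[R]_d)) :=
  [tuple of z.2 :: [tuple proj z.1.1 i | i < N] ++ [tuple proj z.1.2 i | i < N]].
have f_pol : polynomial_in x (fun z => z.2).
  by have [p pE] := polynomial_in_var x ord0; exists p => z; rewrite -pE tnth0.
have V_pol i : polynomial_in x (fun z => proj z.1.1 i).
  have [p pE] := polynomial_in_var x (lift ord0 (lshift N i)).
  by exists p => z; rewrite -pE tnthS tnth_lshift tnth_mktuple.
have W_pol i : polynomial_in x (fun z => proj z.1.2 i).
  have [p pE] := polynomial_in_var x (lift ord0 (rshift N i)).
  by exists p => z; rewrite -pE tnthS tnth_rshift tnth_mktuple.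
have one_pol : polynomial_in x (fun=> 1) by exact: polynomial_in1.
have m_pol : polynomial_in x (fun z => discrepancy z.1.1 z.1.2 z.2).
  apply/polynomial_inD/polynomial_inN/one_pol.
  apply: polynomial_inM; first exact: polynomial_inD.
  by apply: polynomial_in_sum => i; apply: polynomial_inM.
have [p pE] : polynomial_in x (fun z => transported T z.1.1 z.1.2 z.2).
  exact: polynomial_in_reduction.
exists p => V W [y [y_config yV yW]] f Nil_f; rewrite -(pE (V, W, f)) /=.
apply: (phi_inv_transported T_adm T'_adm TT') => //.
- exact: compatible_decomposition y_config yV.
- exact: compatible_decomposition y_config yW.
- by move=> I; apply: compatible_span yV yW.
- by move=> i; rewrite !(compatible_dim sum_d T'_adm _ y_config).
Qed.
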